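(* Let $Y\subseteq\mathbb{R}$ be a Delone set. Let $\psi:\mathbb{N}\to[0,\infty)$ be any function, and let $\alpha$ be a real number with $|\alpha|>1$. If $\sum_{n=1}^\infty \psi(n)<\infty$, then for Lebesgue-almost every $x\in\mathbb{R}$ there are only finitely many pairs $(n,y)$ with $n\in\mathbb{N}$ and $y\in Y$ such that $|\alpha^n x - y|\le \psi(n)$. On the other hand, if $\sum_{n=1}^\infty \psi(n)=\infty$, then for Lebesgue-almost every $x\in\mathbb{R}$ there are infinitely many pairs $(n,y)$ with $n\in\mathbb{N}$ and $y\in Y$ such that $|\alpha^n x - y|\le \psi(n)$.
   Context: A Delone set in $\mathbb{R}$ is a set $Y\subseteq\mathbb{R}$ that is uniformly discrete and relatively dense: there exist $r>0$ (packing radius) such that distinct points of $Y$ are at distance at least $2r$ from each other (equivalently, closed balls of radius $r$ around points of $Y$ have pairwise disjoint interiors), and $R>0$ (covering radius) such that every closed ball of radius $R$ in $\mathbb{R}$ contains a point of $Y$. Here $\mathbb{N}=\{1,2,3,\dots\}$. *)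

(* Defs.v *)
From HB Require Import structures.
From mathcomp Require Import all_boot all_order all_algebra.
From mathcomp Require Import all_classical all_reals all_analysis.
Set Implicit Arguments. Unset Strict Implicit. Unset Printing Implicit Defensive.
Import Order.TTheory GRing.Theory Num.Theory.
Local Open Scope classical_set_scope.
Local Open Scope ring_scope.

Definition delone_set (R : realType) (Y : set R) : Prop :=
  (exists r : R, 0 < r /\
     forall y1 y2, Y y1 -> Y y2 -> y1 <> y2 -> 2 * r <= `|y1 - y2|) /\
  (exists Rc : R, 0 < Rc /\ forall x : R, exists y, Y y /\ `|x - y| <= Rc).

Definition approx_pairs (R : realType) (Y : set R) (psi : nat -> R) (alpha x : R)
  : set (nat * R) :=
  [set p | (1 <= p.1)%N /\ Y p.2 /\ `|alpha ^+ p.1 * x - p.2| <= psi p.1].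

(* Main.v *)
Require Import Defs.
From HB Require Import structures.
From mathcomp Require Import all_boot all_order all_algebra.
From mathcomp Require Import all_classical all_reals all_analysis.
From mathcomp Require Import ring lra zify.
Set Implicit Arguments. Unset Strict Implicit. Unset Printing Implicit Defensive.
Import Order.TTheory GRing.Theory Num.Theory.
Local Open Scope classical_set_scope.
Local Open Scope ring_scope.

(** Write [E_n] for the set of [x] with [|alpha^n x - y| <= psi n] for some [y]
    in [Y]; up to sign it is a union of intervals of radius [psi n / |alpha|^n]
    centred near a lattice of step of order [|alpha|^-n].  Counting these
    intervals bounds the measure of the trace of [E_n] on a bounded interval by a
    constant times [psi n], and Borel-Cantelli settles the convergent case.

    In the divergent case, keep one point of [Y] near each multiple of
    [L = 4 Rc], pass to a residue class of [n] along which the scales grow by a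
    factor at least 64 and the series still diverges, and cap the radii.  For
    [m < n] the overlap of [E_m] and [E_n] in an interval [I] is then at most
    [|I| (8 rho_m rho_n + 20 rho_n lam_m / lam_n)].  Stopping as soon as the radii
    sum to 1/32, Bonferroni's inequality shows that every tail union fills at
    least 1/128 of every interval, and Lebesgue's density theorem upgrades this
    fixed proportion to full measure. *)

(** * Tubes: counting their segments in an interval *)

Definition tube_seg (R : realType) (lam rho : R) (w : int -> R) (k : int) : set R :=
  `[(w k - rho) / lam, (w k + rho) / lam]%classic.

(* The centres are rescaled: [x] lies in the tube when [lam * x] is within [rho]
   of some [w k], where [w k] is always a bounded perturbation of the integer [k]. *)
Definition tube (R : realType) (lam rho : R) (w : int -> R) : set R :=
  \bigcup_(k : int) tube_seg lam rho w k.

Section tubes.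
Variable R : realType.
Implicit Types (lam rho u v x : R) (w : int -> R).
Local Notation mu := (@lebesgue_measure R).

Lemma tube_segE lam rho w k x : 0 < lam ->
  tube_seg lam rho w k x <-> `|lam * x - w k| <= rho.
Proof.
move=> l0; rewrite /tube_seg/= in_itv/= ler_pdivrMr// ler_pdivlMr// ler_norml.
by rewrite mulrC; split=> /andP[a b]; apply/andP; split; lra.
Qed.

Lemma measurable_tube_seg lam rho w k : measurable (tube_seg lam rho w k).
Proof. exact: measurable_itv. Qed.

Lemma measurable_tube lam rho w : measurable (tube lam rho w).
Proof.
apply: countable_bigcupT_measurable; first exact: countableP.
by move=> k; exact: measurable_tube_seg.
Qed.

Lemma lebesgue_measure_cc u v : u <= v ->
  mu `[u, v]%classic = (v - u)%:E.
Proof.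
move=> uv; rewrite lebesgue_measure_itv/= lte_fin; case: ltP => // vu.
by rewrite (@le_anti _ _ u v) ?uv// subrr.
Qed.

Lemma measure_tube_seg lam rho w k : 0 < lam -> 0 <= rho ->
  mu (tube_seg lam rho w k) = (2 * rho / lam)%:E.
Proof.
move=> l0 r0; rewrite lebesgue_measure_cc; first by congr (_%:E); field; lra.
by rewrite ler_pM2r ?invr_gt0//; lra.
Qed.

Lemma measure_cover_le (X : set R) (F : nat -> set R) P (c : R) :
  measurable X -> (forall i, measurable (F i)) ->
  X `<=` \big[setU/set0]_(i < P) F i ->
  (forall i, (i < P)%N -> (mu (F i) <= c%:E)%E) -> (mu X <= (P%:R * c)%:E)%E.
Proof.
move=> mX mF XF Fc.
apply: (le_trans (content_subadditive mu (fun i _ => mF i) mX XF)).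
apply: (@le_trans _ _ (\sum_(i < P) c%:E)%E).
  by apply: lee_sum => i _; exact: Fc.
by rewrite sumEFin lee_fin sumr_const card_ord mulr_natl.
Qed.

(** If segment [k] meets [[u, v]] at [x], then [|lam * x - k| <= rho + 1 <= 2]. So [k] lies in an
    interval of length [lam * (v - u) + 4], which holds at most one more integer than its length. *)
Lemma tube_itv_cover lam rho w u v : 0 < lam -> rho <= 1 ->
  (forall k, `|w k - k%:~R| <= 1) -> u <= v ->
  exists k0 : int, exists2 P : nat, P%:R <= lam * (v - u) + 5 &
    tube lam rho w `&` `[u, v]%classic `<=`
    \big[setU/set0]_(i < P) tube_seg lam rho w (k0 + i%:Z).
Proof.
move=> l0 r1 hw uv.
set a := lam * u - 2; exists (Num.ceil a).
have b0 : 0 <= lam * (v - u) + 4.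
  by rewrite addr_ge0// mulr_ge0 ?subr_ge0// ltW.
exists (Num.truncn (lam * (v - u) + 4)).+1.
  have /andP[h _] := truncn_itv b0.
  by rewrite -natr1; lra.
move=> x [[k _ /(tube_segE _ _ _ _ l0) xk]]; rewrite /= in_itv/= => /andP[ux xv].
have hk := hw k.
have lu : lam * u <= lam * x by rewrite ler_pM2l.
have lv : lam * x <= lam * v by rewrite ler_pM2l.
move: hk (xk); rewrite !ler_norml => /andP[k1 k2] /andP[k3 k4].
have ka : Num.ceil a <= k by rewrite ceil_le_int /a; lra.
rewrite -(bigcup_mkord _ (fun i : nat => tube_seg lam rho w (Num.ceil a + i%:Z))).
exists (`|(k - Num.ceil a)%R|%N); last first.
  have -> : Num.ceil a + `|(k - Num.ceil a)%R|%N%:Z = k by lia.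
  exact/(tube_segE _ _ _ _ l0).
have ha := ceil_ge a.
rewrite /= ltnS truncn_ge_nat// natr_absz ger0_norm ?subr_ge0// intrB.
by rewrite /a in ha *; lra.
Qed.

Lemma measure_tube_itv_le lam rho w u v : 0 < lam -> 0 <= rho <= 1 ->
  (forall k, `|w k - k%:~R| <= 1) -> u <= v ->
  (mu (tube lam rho w `&` `[u, v]%classic) <=
   ((lam * (v - u) + 5) * (2 * rho / lam))%:E)%E.
Proof.
move=> l0 /andP[r0 r1] hw uv; have [k0 [P hP sub]] := tube_itv_cover l0 r1 hw uv.
have mX : measurable (tube lam rho w `&` `[u, v]%classic).
  by apply: measurableI; [exact: measurable_tube|exact: measurable_itv].
apply: (le_trans (measure_cover_le mX (fun i : nat => measurable_tube_seg lam rho w (k0 + i%:Z)) sub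
  (c := 2 * rho / lam) _)).
  by move=> i _; rewrite measure_tube_seg.
rewrite lee_fin ler_wpM2r// divr_ge0 ?mulr_ge0//; lra.
Qed.

(** Perturbation and radius together shift by at most 1/4 + 1/8 = 3/8. Every [k] from
    [lam * u + 3/8] to [lam * v - 3/8] thus gives a segment inside [[u, v]], and these segments are
    disjoint. *)
Lemma measure_tube_itv_ge lam rho w u v : 0 < lam -> 0 <= rho <= 1/8 ->
  (forall k, `|w k - k%:~R| <= 1/4) -> u <= v -> 2 <= lam * (v - u) ->
  (((lam * (v - u) - 2) * (2 * rho / lam))%:E <=
   mu (tube lam rho w `&` `[u, v]%classic))%E.
Proof.
move=> l0 /andP[r0 r1] hw uv luv.
set a := lam * u + 3/8; set k0 := Num.ceil a.
(* 7/4 is twice the margin 3/8, plus 1 lost to the ceiling in [k0]. *)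
have b0 : 0 <= lam * (v - u) - 7/4 by lra.
set P := (Num.truncn (lam * (v - u) - 7/4)).+1.
have /andP[h1 h2] := truncn_itv b0.
pose F i := tube_seg lam rho w (k0 + i%:Z).
have mF i : measurable (F i) by exact: measurable_tube_seg.
(* Two segments with a common point have indices at distance at most 2/4 + 2/8 < 1, hence equal
   indices. *)
have tF : trivIset setT (fun i : 'I_P => F i).
  apply/trivIsetP => i j _ _ ij; apply/seteqP; split=> // x [].
  move=> /(tube_segE _ _ _ _ l0) xi /(tube_segE _ _ _ _ l0) xj.
  have kk : `|((k0 + i%:Z)%:~R - (k0 + j%:Z)%:~R : R)| < 1.
    move: (hw (k0 + i%:Z)) (hw (k0 + j%:Z)) xi xj.
    rewrite !ler_norml ltr_norml => /andP[? ?] /andP[? ?] /andP[? ?] /andP[? ?].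
    by apply/andP; split; lra.
  move: kk; rewrite -intrB -intr_norm -[1]/(1%:~R) ltr_int => kk.
  by case/eqP: ij; apply: val_inj => /=; lia.
apply: (@le_trans _ _ (mu (\big[setU/set0]_(i < P) F i))).
  rewrite measure_bigsetU_ord//; last by move=> i; exact: mF.
  rewrite (eq_bigr (fun=> (2 * rho / lam)%:E)); last first.
    by move=> i _; exact: measure_tube_seg.
  rewrite sumEFin lee_fin sumr_const card_ord -[leRHS]mulr_natl ler_wpM2r//.
    by rewrite divr_ge0 ?mulr_ge0//; lra.
  by rewrite /P; lra.
have mX : measurable (tube lam rho w `&` `[u, v]%classic).
  by apply: measurableI; [exact: measurable_tube|exact: measurable_itv].
rewrite le_measure ?inE//=; first by apply: bigsetU_measurable => i _; exact: mF.
rewrite -(bigcup_mkord _ F) => x [i /= iP Fx]; split; first by exists (k0 + i%:Z).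
move/(tube_segE _ _ _ _ l0): Fx => Fx.
have iT : i%:R <= lam * (v - u) - 7/4.
  by apply: le_trans h1; rewrite ler_nat; rewrite ltnS in iP.
have /andP[c1 c2] := ceil_itv a; rewrite -/k0 intrB mulr1z in c1 c2.
have i0 : 0 <= i%:R :> R := ler0n _ _.
move: (hw (k0 + i%:Z)) Fx; rewrite intrD !ler_norml.
rewrite -pmulrn => /andP[d1 d2] /andP[d3 d4].
rewrite /a in c1 c2.
rewrite /= in_itv/= -(ler_pM2l l0) -[X in _ && X](ler_pM2l l0).
by apply/andP; split; lra.
Qed.
End tubes.

(** Induction on [M]: adding [F M] to the union [U] of the earlier sets gains the measure of [F M]
    minus that of its trace on [U], and subadditivity bounds this trace by the pairwise overlaps. *)
Lemma bonferroni_ge d (T : measurableType d) (R : realType)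
    (mu : {measure set T -> \bar R}) (F : nat -> set T) (a : nat -> R)
    (b : nat -> nat -> R) (N M : nat) :
  (forall n, measurable (F n)) -> (forall n, (mu (F n) < +oo)%E) ->
  (forall n, (N <= n < M)%N -> ((a n)%:E <= mu (F n))%E) ->
  (forall j n, (N <= j < n)%N -> (n < M)%N ->
     (mu (F j `&` F n) <= (b j n)%:E)%E) ->
  ((\sum_(N <= n < M) (a n - \sum_(N <= j < n) b j n))%:E <=
   mu (\big[setU/set0]_(N <= n < M) F n))%E.
Proof.
move=> mF fF aF bF; have [NM|MN] := leqP N M; last first.
  by rewrite !big_geq ?(ltnW MN)// measure0.
elim: M NM aF bF => [|M IH].
  by rewrite leqn0 => /eqP -> _ _; rewrite !big_geq// measure0.
rewrite leq_eqVlt => /predU1P[<- _ _|]; first by rewrite !big_geq// measure0.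
rewrite ltnS => NM aF bF.
rewrite !big_nat_recr//=.
set U := \big[setU/set0]_(N <= n < M) F n.
have mU : measurable U by apply: bigsetU_measurable => i _; exact: mF.
have hI : (mu (U `&` F M) <= (\sum_(N <= j < M) b j M)%:E)%E.
  rewrite -sumEFin /U big_distrl/=.
  (* The length [k] of the union varies while [F M] stays fixed, so that the induction goes
     through. *)
  have : forall k, (N <= k <= M)%N ->
      (mu (\big[setU/set0]_(N <= i < k) (F i `&` F M)) <=
       \sum_(N <= i < k) (b i M)%:E)%E.
    elim => [|k IHk]; first by rewrite leqn0 => /andP[/eqP-> _]; rewrite !big_geq// measure0.
    rewrite leq_eqVlt => /andP[/predU1P[<- _|Nk kM]]; first by rewrite !big_geq// measure0.
    rewrite !big_nat_recr//=.
    apply: (le_trans (measureU2 _ _ _)).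
    - by apply: bigsetU_measurable => i _; exact: measurableI.
    - exact: measurableI.
    - apply: leeD; first by apply: IHk; rewrite -ltnS Nk ltnW.
      by apply: bF => //; rewrite -ltnS Nk.
  by apply; rewrite NM leqnn.
have UF : mu (U `|` F M) = (mu U + (mu (F M `\` U)))%E.
  rewrite -measureU//; last 2 first.
  - exact: measurableD.
  - by apply/seteqP; split => // x [? []].
  congr (mu _); apply/seteqP; split => x.
    by have [xU|xU] := pselect (U x); [left|move=> [//|]; right].
  by move=> [|[]]; [left|right].
rewrite UF EFinD; apply: leeD.
  apply: IH => // [n /andP[Nn nM]|j n jn nM].
    by apply: aF; rewrite Nn ltnW.
  by apply: bF => //; rewrite ltnW.
rewrite (measureD (mF M) mU (fF M)) setIC.
have fin : mu (U `&` F M) \is a fin_num.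
  rewrite ge0_fin_numE//; apply: le_lt_trans hI _; exact: ltry.
by rewrite EFinB; apply: leeB => //; apply: aF; rewrite NM/=.
Qed.

(** * Overlaps of tubes and finite unions at lacunary scales *)

Section tube_union.
Variable R : realType.
Implicit Types (lam rho u v x : R) (w : int -> R).
Local Notation mu := (@lebesgue_measure R).

(* Each of the at most [2 l1 (v - u)] segments of the first tube meeting [u, v]
   is itself an interval to which [measure_tube_itv_le] applies. *)
Lemma measure_tube_pair_le l1 l2 r1 r2 w1 w2 u v :
  0 < l1 -> 0 < l2 -> 0 <= r1 <= 1 -> 0 <= r2 <= 1 ->
  (forall k, `|w1 k - k%:~R| <= 1) -> (forall k, `|w2 k - k%:~R| <= 1) ->
  u <= v -> 10 <= l1 * (v - u) ->
  (mu ((tube l1 r1 w1 `&` `[u, v]%classic) `&` (tube l2 r2 w2 `&` `[u, v]%classic)) <=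
   ((v - u) * (8 * r1 * r2 + 20 * r2 * (l1 / l2)))%:E)%E.
Proof.
move=> l10 l20 /andP[r10 r11] /[dup] r2b /andP[r20 r21] h1 h2 uv luv.
have [k0 [P hP sub]] := tube_itv_cover l10 r11 h1 uv.
have mT l r w : measurable (tube l r w `&` `[u, v]%classic).
  by apply: measurableI; [exact: measurable_tube|exact: measurable_itv].
pose F i := tube l2 r2 w2 `&` tube_seg l1 r1 w1 (k0 + i%:Z).
have mF i : measurable (F i).
  by apply: measurableI; [exact: measurable_tube|exact: measurable_tube_seg].
have c0 : 0 <= (l2 * (2 * r1 / l1) + 5) * (2 * r2 / l2).
  rewrite mulr_ge0//; last by rewrite divr_ge0 ?mulr_ge0// ltW.
  by rewrite addr_ge0// mulr_ge0 ?(ltW l20)// divr_ge0 ?mulr_ge0// ltW.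
apply: (le_trans (@measure_cover_le R _ F P
   ((l2 * (2 * r1 / l1) + 5) * (2 * r2 / l2)) _ mF _ _)).
- exact: measurableI.
- rewrite -(bigcup_mkord _ F) => x [X1 [X2 _]].
  have := sub x X1; rewrite -(bigcup_mkord _ (fun i : nat => tube_seg l1 r1 w1 (k0 + i%:Z))).
  by move=> [i ? ?]; exists i.
- move=> i _; rewrite /F /tube_seg.
  set a := (_ - r1) / l1; set b := (_ + r1) / l1.
  have ab : b - a = 2 * r1 / l1 by rewrite /a /b; field; lra.
  have ab0 : a <= b by rewrite -subr_ge0 ab divr_ge0 ?mulr_ge0// ltW.
  have := measure_tube_itv_le l20 r2b h2 ab0.
  by rewrite ab.
rewrite lee_fin.
(* Since [10 <= l1 * (v - u)], the additive 5 in the count [P] is absorbed by a factor 2. *)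
have -> : (v - u) * (8 * r1 * r2 + 20 * r2 * (l1 / l2)) =
   (2 * (l1 * (v - u))) * ((l2 * (2 * r1 / l1) + 5) * (2 * r2 / l2)).
  by field; lra.
by apply: ler_wpM2r => //; lra.
Qed.

Variables (lam rho : nat -> R) (w : nat -> int -> R).
Hypothesis lam0 : forall n, 0 < lam n.
Hypothesis lamS : forall n, 64 * lam n <= lam n.+1.
Hypothesis rho_bnd : forall n, 0 <= rho n <= 1/8.
Hypothesis hw : forall n k, `|w n k - k%:~R| <= 1/4.

(** Geometric growth with ratio 64: the induction closes because 1/63 + 1 = 64/63. *)
Lemma sum_lam_le N n : \sum_(N <= j < n) lam j <= lam n / 63.
Proof.
have [Nn|nN] := leqP N n; last first.
  by rewrite big_geq ?(ltnW nN)// divr_ge0// ltW.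
elim: n Nn => [|n IH].
  by rewrite leqn0 => /eqP->; rewrite big_geq// divr_ge0// ltW.
rewrite leq_eqVlt => /predU1P[<-|]; first by rewrite big_geq// divr_ge0// ltW.
rewrite ltnS => Nn; rewrite big_nat_recr//=.
by have := IH Nn; have := lamS n; lra.
Qed.

Lemma lam_homo m n : (m <= n)%N -> lam m <= lam n.
Proof.
move=> mn; apply: (@homo_leq _ lam (fun x y => x <= y)) mn => // [y x z|i].
  exact: le_trans.
by have := lamS i; have := lam0 i; lra.
Qed.

(* As long as the radii sum to at most 1/32, the overlaps cost at most
   1/4 + 20/63 of each term of the first-order sum. *)
Lemma measure_bigcup_tube_ge N M u v : u <= v -> 10 <= lam N * (v - u) ->
  (forall n, (n < M)%N -> \sum_(N <= j < n) rho j <= 1/32) ->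
  (((v - u) / 4 * \sum_(N <= j < M) rho j)%:E <=
   mu (\big[setU/set0]_(N <= j < M) (tube (lam j) (rho j) (w j) `&` `[u, v]%classic)))%E.
Proof.
move=> uv luv hS.
pose F j := tube (lam j) (rho j) (w j) `&` `[u, v]%classic.
have mF j : measurable (F j).
  by apply: measurableI; [exact: measurable_tube|exact: measurable_itv].
have uv0 : 0 <= v - u by rewrite subr_ge0.
have lge n : (N <= n)%N -> 10 <= lam n * (v - u).
  by move=> Nn; apply: (le_trans luv); rewrite ler_wpM2r// lam_homo.
have r0 n : 0 <= rho n by have /andP[] := rho_bnd n.
have r1 n : 0 <= rho n <= 1 by have /andP[? ?] := rho_bnd n; apply/andP; split; lra.
have w1 n k : `|w n k - k%:~R| <= 1 by apply: le_trans (hw n k) _; lra.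
apply: (le_trans _ (@bonferroni_ge _ _ R mu F (fun n => (v - u) * rho n)
  (fun j n => (v - u) * (8 * rho j * rho n + 20 * rho n * (lam j / lam n)))
  N M mF _ _ _)).
- rewrite lee_fin mulr_sumr; apply: ler_sum_nat => n /andP[Nn nM].
  rewrite -mulr_sumr -mulrBr -mulrA; apply: ler_wpM2l => //.
  rewrite big_split/=.
  have -> : \sum_(N <= i < n) 8 * rho i * rho n = 8 * rho n * \sum_(N <= i < n) rho i.
    by rewrite mulr_sumr; apply: eq_bigr => i _; ring.
  have -> : \sum_(N <= i < n) 20 * rho n * (lam i / lam n) =
      20 * rho n / lam n * \sum_(N <= i < n) lam i.
    by rewrite mulr_sumr; apply: eq_bigr => i _; ring.
  have h1 : 8 * rho n * \sum_(N <= i < n) rho i <= 8 * rho n * (1/32).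
    by rewrite ler_wpM2l ?mulr_ge0// hS.
  have h2 : 20 * rho n / lam n * \sum_(N <= i < n) lam i <= 20 * rho n / lam n * (lam n / 63).
    by rewrite ler_wpM2l ?sum_lam_le// divr_ge0 ?mulr_ge0// ltW.
  have h3 : 20 * rho n / lam n * (lam n / 63) = 20 / 63 * rho n.
    by field; rewrite gt_eqF.
  by have := r0 n; lra.
- move=> n; apply: le_lt_trans (measure_tube_itv_le (lam0 n) (r1 n) (w1 n) uv) _.
  exact: ltry.
- move=> n /andP[Nn nM]; have ln := lge n Nn.
  apply: le_trans (measure_tube_itv_ge (lam0 n) (rho_bnd n) (hw n) uv _); last lra.
  rewrite lee_fin.
  (* The main term is [2 * (v - u) * rho n]; half of it is given up to absorb the boundary loss, as
     [lam n * (v - u)] is at least 10. *)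
  have -> : (lam n * (v - u) - 2) * (2 * rho n / lam n) =
    (v - u) * rho n + rho n / lam n * (lam n * (v - u) - 4).
    by field; rewrite gt_eqF.
  rewrite lerDl mulr_ge0 ?divr_ge0 ?(ltW (lam0 n))//; lra.
- move=> j n /andP[Nj jn] nM.
  by apply: measure_tube_pair_le => //; exact: lge.
Qed.

End tube_union.

(** * From a fixed proportion to full measure *)

Section density.
Variable R : realType.
Local Notation mu := (@lebesgue_measure R).

(** At almost every point of [A] the density of [A] is 1, while the hypothesis keeps all ratios on
    balls below [c < 1]. Hence [A] lies in the exceptional null set of the density theorem. *)
Lemma negligible_of_sparse (A : set R) (c : R) : measurable A -> c < 1 ->
  (forall u v, u < v -> (mu (A `&` `[u, v]%classic) <= (c * (v - u))%:E)%E) ->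
  mu.-negligible A.
Proof.
move=> mA c1 hA; apply: negligibleS (lebesgue_density mA).
move=> x Ax /=; rewrite indicE mem_set//= => cx.
have : (1%:E <= c%:E)%E.
  apply: (cvge_le _ cx) => //.
  near=> r.
  have r0 : 0 < r by near: r; exact: nbhs_right_gt.
  rewrite lebesgue_measure_ball ?(ltW r0)// inver mulrn_eq0/= gt_eqF//.
  rewrite lee_pdivrMr; last by rewrite mulrn_wgt0.
  have -> : (c%:E * (r *+ 2)%:E)%E = (c * ((x + r) - (x - r)))%:E.
    by rewrite -EFinM; congr (_%:E); ring.
  apply: le_trans (hA (x - r) (x + r) _); last by lra.
  rewrite le_measure ?inE//=.
  - by apply: measurableI => //; rewrite ball_itv; exact: measurable_itv.
  - by apply: measurableI => //; exact: measurable_itv.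
  - apply: setIS; rewrite ball_itv => y /=; rewrite !in_itv/= => /andP[? ?].
    by apply/andP; split; apply: ltW.
by rewrite lee_fin leNgt c1.
Unshelve. all: by end_near. Qed.

End density.

(** * Divergent case for tubes *)

Section tube_limsup.
Variable R : realType.
Local Notation mu := (@lebesgue_measure R).
Variables (lam rho : nat -> R) (w : nat -> int -> R).
Hypothesis lam0 : forall n, 0 < lam n.
Hypothesis lamS : forall n, 64 * lam n <= lam n.+1.
Hypothesis rho_bnd : forall n, 0 <= rho n <= 1/8.
Hypothesis hw : forall n k, `|w n k - k%:~R| <= 1/4.
Hypothesis rho_div : forall N, exists M, 1/32 <= \sum_(N <= j < M) rho j.

(** Linear growth is enough to find a scale that is fine compared with a given interval. *)
Lemma lam_ge_linear n : n.+1%:R * lam 0%N <= lam n.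
Proof.
elim: n => [|n IH]; first by rewrite mul1r.
have := lamS n; have := lam0 n; have h0 := lam0 0%N.
rewrite -natr1 mulrDl mul1r.
have : lam 0%N <= n.+1%:R * lam 0%N by rewrite ler_peMl ?(ltW h0)// ler1n.
by lra.
Qed.

Lemma measure_tube_tail_ge N u v : u < v ->
  (((v - u) / 128)%:E <=
   mu (\bigcup_(j in [set j | (N <= j)%N]) tube (lam j) (rho j) (w j)
       `&` `[u, v]%classic))%E.
Proof.
move=> uv.
have l0 : 0 < lam 0%N * (v - u) by rewrite mulr_gt0// subr_gt0.
(* Starting at [K] instead of [N] makes the scale fine enough: [lam K * (v - u)] is at least 10. *)
pose K := maxn N (Num.truncn (10 / (lam 0%N * (v - u)))).
have hK : 10 <= lam K * (v - u).
  have : 10 / (lam 0%N * (v - u)) <= K.+1%:R.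
    apply: le_trans (ltW (truncnS_gt _)) _.
    by rewrite ler_nat ltnS leq_maxr.
  rewrite ler_pdivrMr// mulrA => /le_trans; apply.
  by rewrite ler_wpM2r ?lam_ge_linear// subr_ge0 ltW.
have exM : exists M, 1/32 <= \sum_(K <= j < M) rho j by exact: rho_div.
(* Minimality of [M] keeps all shorter sums below 1/32, as the overlap estimate requires, while the
   full sum reaches 1/32 and yields (1/4)(1/32) = 1/128. *)
have [M hM minM] := ex_minnP exM.
have hS n : (n < M)%N -> \sum_(K <= j < n) rho j <= 1/32.
  by move=> nM; rewrite leNgt; apply/negP => /ltW /minM; rewrite leqNgt nM.
have := measure_bigcup_tube_ge lam0 lamS rho_bnd hw (ltW uv) hK hS.
have mF j : measurable (tube (lam j) (rho j) (w j) `&` `[u, v]%classic).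
  by apply: measurableI; [exact: measurable_tube|exact: measurable_itv].
move=> h; apply: (le_trans (le_trans _ h)).
  rewrite lee_fin.
  have : (v - u) / 4 * (1/32) <= (v - u) / 4 * \sum_(K <= j < M) rho j.
    by rewrite ler_wpM2l// divr_ge0// subr_ge0 ltW.
  by lra.
rewrite le_measure ?inE//=.
- by apply: bigsetU_measurable => j _; exact: mF.
- apply: measurableI; last exact: measurable_itv.
  by apply: bigcup_measurable => j _; exact: measurable_tube.
- rewrite big_nat_cond.
  apply: (big_ind (fun X => X `<=` _)) => //.
    by move=> X Y XU YU x [/XU|/YU].
  move=> j /andP[/andP[Kj _] _] x [tx ux]; split=> //; exists j => //=.
  by apply: leq_trans Kj; exact: leq_maxl.
Qed.

Lemma ae_tube_infinitely_often :
  {ae mu, forall x, forall N, exists2 j, (N <= j)%N & tube (lam j) (rho j) (w j) x}.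
Proof.
apply: ae_foralln => N.
set V := \bigcup_(j in [set j | (N <= j)%N]) tube (lam j) (rho j) (w j).
have mV : measurable V.
  by apply: bigcup_measurable => j _; exact: measurable_tube.
suff : mu.-negligible (~` V).
  by apply: negligibleS => x /= hx [j /= Nj tj]; apply: hx; exists j.
apply: (@negligible_of_sparse _ _ (127/128)); first exact: measurableC.
  by lra.
move=> u v uv; have mI : measurable (`[u, v]%classic : set R) by exact: measurable_itv.
have muI : mu `[u, v]%classic = (v - u)%:E by rewrite lebesgue_measure_cc// ltW.
rewrite setIC -setDE measureD//=; last by rewrite muI ltry.
rewrite muI setIC.
have := measure_tube_tail_ge N uv; rewrite -/V.
have -> : (127 / 128 * (v - u))%:E = ((v - u)%:E - ((v - u) / 128)%:E)%E.
  by rewrite -EFinB; congr (_%:E); field.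
by move=> h; apply: leeB.
Qed.

End tube_limsup.

(** * Nonnegative series: residue classes and capped terms *)

Section nonneg_series.
Variable R : realType.
Implicit Type f : nat -> R.

Lemma nneseries_le_bound (u : nat -> \bar R) N (B : \bar R) :
  (forall n, (N <= n)%N -> (0 <= u n)%E) ->
  (forall M, (\sum_(N <= n < M) u n <= B)%E) -> (\sum_(N <= n <oo) u n <= B)%E.
Proof.
move=> u0 uB; apply: lime_le; first by apply: is_cvg_nneseries => n Nn _; exact: u0.
by apply: nearW => M; exact: uB.
Qed.

Lemma bounded_series_small f B e : (forall n, 0 <= f n) ->
  (forall M, \sum_(0 <= j < M) f j <= B) -> 0 < e ->
  exists N, forall n, (N <= n)%N -> f n <= e.
Proof.
move=> f0 fB e0.
have : (\sum_(0 <= n <oo) (f n)%:E < +oo)%E.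
  apply: (@le_lt_trans _ _ B%:E); last exact: ltry.
  apply: nneseries_le_bound => [n _|M]; first by rewrite lee_fin.
  by rewrite sumEFin lee_fin.
move=> /(nnseries_is_cvg f0)/cvg_series_cvg_0 /cvgr0Pnorm_le /(_ _ e0).
move=> [N _ hN]; exists N => n Nn.
by have := hN n Nn; rewrite /= ger0_norm.
Qed.

(** If the sums along every residue were bounded, adding the bounds for [r < q] would bound the
    whole series. *)
Lemma unbounded_residue f q : (0 < q)%N -> (forall n, 0 <= f n) ->
  (forall B, exists M, B <= \sum_(0 <= n < M) f n) ->
  exists r, forall B, exists M, B <= \sum_(0 <= j < M) f (q * j + r)%N.
Proof.
move=> q0 f0 fdiv; apply: contrapT => /forallNP h.
have hB r : exists B, forall M, \sum_(0 <= j < M) f (q * j + r)%N < B.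
  have /existsNP[B /forallNP hB] := h r.
  by exists B => M; rewrite ltNge; apply/negP.
have [B BP] := choice hB.
have [M] := fdiv (\sum_(0 <= r < q) B r).
apply/negP; rewrite -ltNge.
(* The first [q * K] terms are regrouped by residue modulo [q]. *)
have blk K : \sum_(0 <= n < q * K) f n = \sum_(0 <= r < q) \sum_(0 <= j < K) f (q * j + r)%N.
  elim: K => [|K IH].
    by rewrite muln0 big_geq// big1// => r _; rewrite big_geq.
  under [RHS]eq_bigr do rewrite big_nat_recr//=.
  rewrite big_split/= -IH mulnS addnC.
  rewrite (@big_cat_nat _ _ _ (q * K)%N) ?leq_addr//=; congr (_ + _).
  rewrite -{1}[(q * K)%N]add0n big_addn addKn.
  by apply: eq_bigr => r _; rewrite addnC.
apply: (@le_lt_trans _ _ (\sum_(0 <= n < q * M) f n)).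
  rewrite (@big_cat_nat _ _ _ M 0%N (q * M)%N) ?leq_pmull//= lerDl.
  by apply: sumr_ge0.
by rewrite blk; apply: ltr_sum_nat.
Qed.

(** Either some term past [N] reaches [e], and then its capped value alone suffices, or the cap
    changes nothing past [N] and the tail still diverges. *)
Lemma divergent_tail_min f e : 0 < e -> (forall n, 0 <= f n) ->
  (forall B, exists M, B <= \sum_(0 <= n < M) f n) ->
  forall N, exists M, e <= \sum_(N <= j < M) Num.min (f j) e.
Proof.
move=> e0 f0 fdiv N.
have m0 j : 0 <= Num.min (f j) e by rewrite le_min f0 ltW.
have [[j Nj ej]|h] := pselect (exists2 j, (N <= j)%N & e <= f j).
  exists j.+1; rewrite big_nat_recr//= (min_idPr ej) lerDr.
  by apply: sumr_ge0.
have [M hM] := fdiv (\sum_(0 <= n < N) f n + e).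
have NM : (N <= M)%N.
  rewrite leqNgt; apply/negP => MN.
  move: hM; rewrite (@big_cat_nat _ _ _ M 0%N N) ?(ltnW MN)//=.
  have : 0 <= \sum_(M <= n < N) f n by apply: sumr_ge0.
  by lra.
exists M; move: hM; rewrite (@big_cat_nat _ _ _ N 0%N M)//= lerD2l => /le_trans; apply.
apply: ler_sum_nat => j /andP[Nj _]; rewrite le_min lexx/= leNgt; apply/negP => ej.
by apply: h; exists j => //; exact: ltW.
Qed.

End nonneg_series.

(** * Convergent case for tubes *)

Section tube_convergence.
Variable R : realType.
Local Notation mu := (@lebesgue_measure R).

(** Borel-Cantelli applies on each [[-K, K]], and countably many of these intervals exhaust the
    line. *)
Lemma ae_tube_finitely_often (lam rho : nat -> R) (w : nat -> int -> R) (l B : R) :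
  0 < l -> (forall n, l <= lam n) -> (forall n, 0 <= rho n) ->
  (forall n k, `|w n k - k%:~R| <= 1) ->
  (forall M, \sum_(0 <= j < M) rho j <= B) ->
  {ae mu, forall x, exists N, forall n, (N <= n)%N -> ~ tube (lam n) (rho n) (w n) x}.
Proof.
move=> l0 llam r0 hw rB.
have lam0 n : 0 < lam n by exact: lt_le_trans (llam n).
have [N0 hN0] := bounded_series_small r0 rB ltr01.
suff H (K : nat) : {ae mu, forall x, `[- K%:R, K%:R]%classic x ->
    exists N, forall n, (N <= n)%N -> ~ tube (lam n) (rho n) (w n) x}.
  have := ae_foralln H; apply: filterS => x hx.
  apply: (hx (Num.truncn `|x|).+1).
  by rewrite /= in_itv/= -ler_norml; apply/ltW; exact: truncnS_gt.
(* The sets before [N0] are emptied because the measure bound needs radii at most 1; this does not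
   affect the limsup. *)
pose G n := if (N0 <= n)%N then tube (lam n) (rho n) (w n) `&` `[- K%:R, K%:R]%classic
            else set0.
have mG n : measurable (G n).
  rewrite /G; case: ifP => // _.
  by apply: measurableI; [exact: measurable_tube|exact: measurable_itv].
(* Expanding [(lam n * 2K + 5) * (2 * rho n / lam n)] gives [(4K + 10 / lam n) * rho n], and
   [l <= lam n]. *)
pose C : R := 4 * K%:R + 10 / l.
have C0 : 0 <= C.
  by apply: addr_ge0; [rewrite mulr_ge0|rewrite divr_ge0// ltW].
have GC n : (mu (G n) <= (C * rho n)%:E)%E.
  rewrite /G; case: ifPn => [Nn|_]; last by rewrite measure0 lee_fin mulr_ge0.
  have r1 : 0 <= rho n <= 1 by rewrite r0 hN0.
  have KK : - K%:R <= K%:R :> R by rewrite (@le_trans _ _ 0)// oppr_le0.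
  apply: le_trans (measure_tube_itv_le (lam0 n) r1 (hw n) KK) _.
  rewrite lee_fin.
  have -> : (lam n * (K%:R - - K%:R) + 5) * (2 * rho n / lam n) =
     (4 * K%:R + 10 / lam n) * rho n by field; rewrite gt_eqF.
  rewrite ler_wpM2r// lerD2l ler_wpM2l// lef_pV2// posrE//.
have : mu (lim_sup_set G) = 0%E.
  apply: lim_sup_set_cvg0 => //.
  apply: (@le_lt_trans _ _ (C * B)%:E); last exact: ltry.
  apply: nneseries_le_bound => [n _|M]; first exact: measure_ge0.
  apply: (@le_trans _ _ (\sum_(0 <= n < M) (C * rho n)%:E)%E).
    by apply: lee_sum => n _; exact: GC.
  by rewrite sumEFin lee_fin -mulr_sumr ler_wpM2l.
have mL : measurable (lim_sup_set G).
  apply: bigcap_measurable => // n _.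
  by apply: bigcup_measurable => j _; exact: mG.
move=> /(negligibleP mu mL); apply: negligibleS => x /= /not_implyP[Kx hx] N _.
have /existsNP[n /not_implyP[Nn /contrapT tn]] := (forallNP _).2 hx (maxn N N0).
have [Nn1 Nn2] : (N <= n)%N /\ (N0 <= n)%N by apply/andP; rewrite -geq_max.
by exists n => //=; rewrite /G Nn2; split.
Qed.

End tube_convergence.

(** Bernoulli's inequality; it supplies the step [q] for which the scales grow by a factor at least
    64. *)
Lemma exists_expr_ge (R : archiRealFieldType) (b C : R) : 1 < b -> exists2 q, (0 < q)%N & C <= b ^+ q.
Proof.
move=> b1; pose q := (Num.truncn (C / (b - 1))).+1; exists q => //.
have b0 : 0 < b - 1 by rewrite subr_gt0.
have Bernoulli n : 1 + n%:R * (b - 1) <= b ^+ n.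
  elim: n => [|n IH]; first by rewrite mul0r addr0 expr0.
  rewrite exprS; apply: le_trans (_ : b * (1 + n%:R * (b - 1)) <= _); last first.
    by rewrite ler_wpM2l//; lra.
  have : 0 <= n%:R * (b - 1) * (b - 1) by rewrite !mulr_ge0// ltW.
  by rewrite -natr1; lra.
apply: le_trans (Bernoulli q).
have : C / (b - 1) < q%:R by exact: truncnS_gt.
by rewrite ltr_pdivrMr//; lra.
Qed.

Lemma infinite_set_fst (T : Type) (A : set (nat * T)) :
  (forall N, exists2 p, (N <= p.1)%N & A p) -> infinite_set A.
Proof.
move=> h Afin.
have /finite_fsetP[X AX] : finite_set (fst @` A) by exact: finite_image.
have [[n y] /= Nn Any] := h (\max_(i <- finmap.enum_fset X) i).+1.
have : (fst @` A) n by exists (n, y).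
rewrite AX /= => nX.
by move: Nn; rewrite ltnNge (leq_bigmax_seq _ nX).
Qed.

(** * From approximation by [Y] to tubes *)

Section approx.
Variables (R : realType) (Y : set R) (psi : nat -> R) (alpha : R).
Local Notation mu := (@lebesgue_measure R).
Hypothesis psi0 : forall n, (1 <= n)%N -> 0 <= psi n.
Hypothesis alpha1 : 1 < `|alpha|.

(* Multiplying [alpha ^+ n * x - y] by [sg alpha ^+ n] replaces [alpha] by
   its absolute value, at the cost of reflecting [Y] when [n] is odd. *)
Let eps n : R := Num.sg alpha ^+ n.

Let alpha0 : alpha != 0.
Proof. by rewrite -normr_gt0 (lt_trans ltr01). Qed.

Lemma sgX_sqr n : eps n * eps n = 1.
Proof. by rewrite /eps -exprMn -expr2 sqr_sg alpha0 expr1n. Qed.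

Lemma norm_sgX n : `|eps n| = 1.
Proof. by rewrite /eps normrX normr_sg alpha0 expr1n. Qed.

(** The two expressions differ by the factor [eps n / c], of absolute value [1 / c]. The spacing [c]
    is later [2 * r] or [4 * Rc]. *)
Lemma approx_rescale (c : R) n (x y : R) : 0 < c ->
  (`|alpha ^+ n * x - y| <= psi n) =
  (`| `|alpha| ^+ n / c * x - eps n * y / c| <= psi n / c).
Proof.
move=> c0; rewrite ler_pdivlMr// -[X in _ = (_ * X <= _)](gtr0_norm c0) -normrM.
have -> : (`|alpha| ^+ n / c * x - eps n * y / c) * c =
    eps n * (alpha ^+ n * x - y).
  rewrite -[in RHS](mulr_sg_norm alpha) exprMn -/(eps n) mulrBr !mulrA sgX_sqr.
  by field; rewrite gt_eqF.
by rewrite normrM norm_sgX mul1r.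
Qed.

Lemma ae_finite_approx_pairs (r : R) : 0 < r ->
  (forall y1 y2, Y y1 -> Y y2 -> y1 <> y2 -> 2 * r <= `|y1 - y2|) ->
  (\sum_(1 <= n <oo) (psi n)%:E < +oo)%E ->
  {ae mu, forall x, finite_set (approx_pairs Y psi alpha x)}.
Proof.
move=> r0 Yr sum_fin.
pose c := 2 * r; have c0 : 0 < c by rewrite mulr_gt0.
(* Rescaled by [c = 2 * r], distinct points of [Y] are at distance at least 1, so each cell
   [[k, k + 1)] holds at most one, which becomes the centre [wk]. An empty cell gets the default
   centre [k], which can only enlarge the tube. *)
have hw nk : exists wk : R, `|wk - nk.2%:~R| <= 1 /\
    forall y, Y y -> Num.floor (eps nk.1 * y / c) = nk.2 -> wk = eps nk.1 * y / c.
  case: nk => n k /=.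
  have [[y [Yy yk]]|h] := pselect (exists y, Y y /\ Num.floor (eps n * y / c) = k); last first.
    by exists k%:~R; split => [|y Yy yk]; [rewrite subrr normr0|case: h; exists y].
  exists (eps n * y / c); split.
    have := floor_itv (eps n * y / c); rewrite yk intrD mulr1z => /andP[? ?].
    by rewrite ger0_norm; lra.
  move=> z Yz zk; congr (_ * _ / _); apply: contrapT => /(Yr _ _ Yy Yz).
  apply/negP; rewrite -ltNge -/c.
  have h : `|eps n * y / c - eps n * z / c| < 1.
    have := floor_itv (eps n * y / c); have := floor_itv (eps n * z / c).
    rewrite yk zk intrD mulr1z => /andP[? ?] /andP[? ?].
    by rewrite ltr_norml; apply/andP; split; lra.
  by move: h; rewrite -mulrBl -mulrBr !normrM norm_sgX mul1r normfV (gtr0_norm c0)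
    ltr_pdivrMr// mul1r.
have [W WP] := choice hw.
have [B hB] : exists B, forall M, \sum_(0 <= j < M) psi j.+1 / c <= B.
  exists (fine (\sum_(1 <= n <oo) (psi n)%:E)%E / c) => M.
  rewrite -mulr_suml ler_wpM2r ?invr_ge0 ?(ltW c0)// -lee_fin fineK; last first.
    rewrite ge0_fin_numE//; apply: nneseries_ge0 => n n1 _.
    by rewrite lee_fin psi0.
  rewrite -sumEFin -[in leLHS](big_add1 _ _ 0%N M.+1 xpredT (fun n => (psi n)%:E)).
  by apply: nneseries_lim_ge => n n1 _; rewrite lee_fin psi0.
pose lam n := `|alpha| ^+ n.+1 / c.
have lamc n : c^-1 <= lam n.
  by rewrite /lam ler_peMl ?invr_ge0 ?(ltW c0)// exprn_ege1// ltW.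
have rho0 n : 0 <= psi n.+1 / c by rewrite divr_ge0 ?psi0// ltW.
have ci0 : 0 < c^-1 by rewrite invr_gt0.
have := @ae_tube_finitely_often R lam (fun n => psi n.+1 / c)
  (fun n k => W (n.+1, k)) c^-1 B ci0 lamc rho0 (fun n k => (WP (n.+1, k)).1) hB.
apply: (@filterS _ _ (ae_filter_ringOfSetsType mu)) => x [N hN].
have lam0 n : 0 < lam n by exact: lt_le_trans (lamc n).
pose K n := [set k | `|lam n * x - W (n.+1, k)| <= psi n.+1 / c].
(* Finitely many exponents do not suffice: each one must also admit only finitely many centres. Here
   [|k|] is at most [b]. *)
have finK n : finite_set (K n).
  pose b := `|lam n * x| + psi n.+1 / c + 1.
  apply: (@sub_finite_set _ _ ((fun i : nat => Num.floor (- b) + i%:Z) @`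
     `I_(Num.truncn (2 * b + 1)).+1)); last exact/finite_image/finite_II.
  move=> k; rewrite /K/= => hk.
  have kb : `|k%:~R| <= b.
    have -> : k%:~R = lam n * x - (lam n * x - W (n.+1, k)) - (W (n.+1, k) - k%:~R) by ring.
    apply: (le_trans (ler_normB _ _)); apply: lerD; last exact: (WP (n.+1, k)).1.
    by apply: (le_trans (ler_normB _ _)); rewrite lerD2l.
  move: kb; rewrite ler_norml => /andP[kb1 kb2].
  have /andP[f1 f2] := floor_itv (- b); rewrite intrD mulr1z in f2.
  have fk : Num.floor (- b) <= k by rewrite -(ler_int R) (le_trans f1).
  have {}f2 : - b - 1 < (Num.floor (- b))%:~R by rewrite ltrBlDr.
  have b0 : 0 <= b by rewrite /b !addr_ge0.
  exists `|(k - Num.floor (- b))%R|%N; last first.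
    by rewrite /= gez0_abs ?subr_ge0// addrC subrK.
  rewrite /= ltnS truncn_ge_nat; last by rewrite addr_ge0// mulr_ge0.
  by rewrite natr_absz ger0_norm ?subr_ge0// intrB; clearbody b; lra.
(* A pair is recovered from its exponent and its cell index: as [eps] squares to 1, multiplying the
   centre by [eps n.+1 * c] gives back [y]. *)
apply: (@sub_finite_set _ _ (\bigcup_(n in `I_N)
   ((fun k => (n.+1, eps n.+1 * c * W (n.+1, k))) @` K n))); last first.
  by apply: bigcup_finite => [|n _]; [exact: finite_II|exact: finite_image].
move=> [[|n] y]; first by case.
move=> [/= _ [Yy]]; rewrite (approx_rescale _ _ _ c0) => hy.
have Wy := (WP (n.+1, Num.floor (eps n.+1 * y / c))).2 y Yy erefl.
have Kn : K n (Num.floor (eps n.+1 * y / c)) by rewrite /K/= Wy.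
exists n => /=.
  rewrite ltnNge; apply/negP => /hN; apply.
  by exists (Num.floor (eps n.+1 * y / c)) => //; exact/(tube_segE _ _ _ _ (lam0 n)).
exists (Num.floor (eps n.+1 * y / c)) => //.
rewrite Wy; congr pair.
have -> : eps n.+1 * c * (eps n.+1 * y / c) = (eps n.+1 * eps n.+1) * y.
  by field; rewrite gt_eqF.
by rewrite sgX_sqr mul1r.
Qed.

Lemma ae_infinite_approx_pairs (Rc : R) : 0 < Rc ->
  (forall x, exists y, Y y /\ `|x - y| <= Rc) ->
  (\sum_(1 <= n <oo) (psi n)%:E = +oo)%E ->
  {ae mu, forall x, infinite_set (approx_pairs Y psi alpha x)}.
Proof.
move=> Rc0 YR sum_inf.
pose L := 4 * Rc; have L0 : 0 < L by rewrite mulr_gt0.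
(* Picking a point within [Rc] of each signed multiple of [L = 4 * Rc] leaves, after division by
   [L], a perturbation of at most 1/4. *)
have hY nk : exists y, Y y /\ `|eps nk.1 * nk.2%:~R * L - y| <= Rc by exact: YR.
have [y yP] := choice hY.
have [q q0 hq] := exists_expr_ge 64 alpha1.
pose f n := psi n.+1 / L.
have f0 n : 0 <= f n by rewrite divr_ge0 ?psi0// ltW.
have fdiv B : exists M, B <= \sum_(0 <= n < M) f n.
  apply: contrapT => /forallNP h.
  suff : (\sum_(1 <= n <oo) (psi n)%:E <= (B * L)%:E)%E by rewrite sum_inf.
  apply: nneseries_le_bound => [n n1|M]; first by rewrite lee_fin psi0.
  rewrite big_add1 sumEFin lee_fin -ler_pdivrMr// mulr_suml.
  by have /negP := h M.-1; rewrite -ltNge => /ltW.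
have [r fr] := unbounded_residue q0 f0 fdiv.
pose n_ j := (q * j + r).+1.
pose lam j := `|alpha| ^+ n_ j / L.
(* The cap 1/32 matches the stopping threshold and also keeps the radii below 1/8; shrinking a
   radius only makes the approximation stricter. *)
pose rho j := Num.min (f (q * j + r)%N) (1/32).
pose w j k := eps (n_ j) * y (n_ j, k) / L.
have lam0 j : 0 < lam j by rewrite divr_gt0// exprn_gt0// (lt_trans ltr01).
have lamS j : 64 * lam j <= lam j.+1.
  have -> : lam j.+1 = `|alpha| ^+ q * lam j.
    by rewrite /lam /n_ mulnS -addnA -addnS exprD mulrA.
  by rewrite ler_wpM2r// ltW.
have rho_bnd j : 0 <= rho j <= 1/8.
  rewrite /rho le_min f0 ge_min /=; apply/andP; split; first by lra.
  by apply/orP; right; lra.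
have hw j k : `|w j k - k%:~R| <= 1/4.
  have := (yP (n_ j, k)).2; rewrite /= distrC => h.
  have -> : w j k - k%:~R = eps (n_ j) / L * (y (n_ j, k) - eps (n_ j) * k%:~R * L).
    rewrite mulrBr -[in LHS](mul1r k%:~R) -(sgX_sqr (n_ j)) /w.
    by field; rewrite gt_eqF.
  rewrite !normrM norm_sgX !mul1r normfV (gtr0_norm L0) ler_pdivrMl//.
  by apply: (le_trans h); rewrite /L; lra.
have rho_div : forall N, exists M, 1/32 <= \sum_(N <= j < M) rho j.
  by apply: divergent_tail_min => //; lra.
have := ae_tube_infinitely_often lam0 lamS rho_bnd hw rho_div.
apply: (@filterS _ _ (ae_filter_ringOfSetsType mu)) => x hx.
(* Unbounded exponents [n_ j] already make the pairs infinite in number, even if points [y]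
   repeat. *)
apply: infinite_set_fst => N.
have [j Nj [k _ /(tube_segE _ _ _ _ (lam0 j)) xk]] := hx N.
exists (n_ j, y (n_ j, k)) => /=.
  by rewrite /n_ -addnS; apply: leq_trans Nj _; rewrite (leq_trans (leq_pmull j q0))// leq_addr.
split=> //; split; first exact: (yP (n_ j, k)).1.
rewrite /= (approx_rescale _ _ _ L0); apply: (le_trans xk).
by rewrite /rho ge_min lexx.
Qed.

End approx.

Theorem mainTheorem1 (R : realType) (Y : set R) (psi : nat -> R) (alpha : R) :
  delone_set Y ->
  (forall n, (1 <= n)%N -> 0 <= psi n) ->
  1 < `|alpha| ->
  ((\sum_(1 <= n <oo) (psi n)%:E < +oo)%E ->
     {ae (@lebesgue_measure R), forall x, finite_set (approx_pairs Y psi alpha x)}) /\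
  ((\sum_(1 <= n <oo) (psi n)%:E = +oo)%E ->
     {ae (@lebesgue_measure R), forall x, infinite_set (approx_pairs Y psi alpha x)}).
Proof.
move=> [[r [r0 Yr]] [Rc [Rc0 YR]]] psi0 alpha1; split.
  exact: ae_finite_approx_pairs r0 Yr.
exact: ae_infinite_approx_pairs Rc0 YR.
Qed.
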